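(* Let $\mathscr C$ be a category. To give a tangent indexing functor $F:\mathscr C^{\mathrm{op}}\to\mathbf{Cat}$ it is necessary and sufficient to define a pseudofunctor $\underline F:\mathscr C^{\mathrm{op}}\to\mathfrak{Tan}_{\mathrm{strong}}$.
   Context: Tangent categories. A tangent structure $\mathbb T=(T,p,0,+,\ell,c)$ on a category $\mathscr D$ consists of a functor $T:\mathscr D\to\mathscr D$ and natural transformations $p:T\Rightarrow\mathrm{id}$, $0:\mathrm{id}\Rightarrow T$, $+:T_2\Rightarrow T$, $\ell:T\Rightarrow T^2$, $c:T^2\Rightarrow T^2$ such that: (1) for every object $A$ and $n\in\mathbb N$ the $n$-fold pullback power $T_nA$ of $p_A:TA\to A$ exists and is preserved by all $T^m$; (2) $(p_A,+_A,0_A)$ is a commutative monoid in $\mathscr D_{/A}$; (3) $T(p_A)\ell_A=0_Ap_A$, $\ell_A\circ{+_A}=T(+_A)\circ\langle\ell_A\pi_1,\ell_A\pi_2\rangle$, $\ell_A0_A=T(0_A)0_A$; (4) $p_{TA}c_A=T(p_A)$, $c_A\circ T(+_A)={+_{TA}}\circ\langle c_AT(\pi_1),c_AT(\pi_2)\rangle$, $c_AT(0_A)=0_{TA}$; (5) $c_Ac_A=\mathrm{id}$, $c_A\ell_A=\ell_A$, $T(\ell_A)\ell_A=\ell_{TA}\ell_A$, $c_{TA}T(c_A)c_{TA}=T(c_A)c_{TA}T(c_A)$, $c_{TA}T(c_A)\ell_{TA}=T(\ell_A)c_A$; (6) $T(+_A)\circ\langle\ell_A\pi_1,0_{TA}\pi_2\rangle:T_2A\to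 T^2A$ is an equalizer of $T(p_A)$ and $0_A\,p_A\,p_{TA}:T^2A\rightrightarrows TA$. $\mathfrak{Tan}_{\mathrm{strong}}$: objects tangent categories; $1$-cells $(\mathscr D,\mathbb T)\to(\mathscr E,\mathbb S)$, $\mathbb S=(S,q,0',\oplus,\ell',c')$, are strong tangent morphisms $(H,\alpha)$: a functor $H$ preserving the pullbacks and equalizers of the tangent structure and a natural isomorphism $\alpha:HT\Rightarrow SH$ with $(q H)\alpha=Hp$, $\alpha (H0)=0'H$, $\alpha (H{+})=(\oplus H)\alpha_2$, $(\ell' H)\alpha=(S\alpha)(\alpha T)(H\ell)$, $(c'H)(S\alpha)(\alpha T)=(S\alpha)(\alpha T)(Hc)$; composition $(G,\beta)(H,\alpha)=(GH,(\beta H)(G\alpha))$; $2$-cells $(H,\alpha)\Rightarrow(K,\beta)$ are natural $\rho:H\Rightarrow K$ with $(S\rho)\alpha=\beta(\rho T)$. Tangent indexing functors. Pseudofunctors are normalized. A pseudofunctor $F:\mathscr C^{\mathrm{op}}\to\mathbf{Cat}$ is a tangent indexing functor if (i) each $F(X)$ is equipped with a tangent structure ${}_X\mathbb T$ with tangent functor ${}_XT$; (ii) for each $f:X\to Y$ there is a natural isomorphism ${}_fT:F(f)\circ{}_YT\Rightarrow{}_XT\circ F(f)$ such that $(F(f),{}_fT):(F(Y),{}_Y\mathbb T)\to(F(X),{}_X\mathbb T)$ is a strong tangent morphism; (iii) the functors ${}_XT$ together with the isomorphisms ${}_fT^{-1}$ form a pseudonatural transformation $T:F\Rightarrow F$.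 The correspondence meant is $\underline F(X)=(F(X),{}_X\mathbb T)$, $\underline F(f)=(F(f),{}_fT)$, with the same compositors; conversely $F=\mathrm{Forget}\circ\underline F$ with the tangent structures and distributive laws supplied by $\underline F$. *)

(* Defs.v *)
From mathcomp Require Import ssreflect ssrfun ssrbool eqtype ssrnat fintype.
From Stdlib Require Import FunctionalExtensionality ProofIrrelevance ClassicalEpsilon.

Set Implicit Arguments.
Unset Strict Implicit.
Unset Printing Implicit Defensive.
Set Primitive Projections.

Record Category := MkCategory {
  ob :> Type;
  hom : ob -> ob -> Type;
  idm : forall x, hom x x;
  cmp : forall x y z, hom y z -> hom x y -> hom x z;
  cmp1m : forall x y (f : hom x y), cmp (idm y) f = f;
  cmpm1 : forall x y (f : hom x y), cmp f (idm x) = f;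
  cmpA : forall x y z w (h : hom z w) (g : hom y z) (f : hom x y),
      cmp h (cmp g f) = cmp (cmp h g) f }.

Arguments hom {c} x y.
Arguments idm {c} x.
Arguments cmp {c x y z} g f.

Declare Scope cat_scope.
Delimit Scope cat_scope with cat.
Local Open Scope cat_scope.
Notation "g ∘ f" := (cmp g f) (at level 40, left associativity) : cat_scope.

Definition op (C : Category) : Category :=
  {| ob := ob C;
     hom := fun x y => @hom C y x;
     idm := fun x => @idm C x;
     cmp := fun x y z g f => @cmp C z y x f g;
     cmp1m := fun x y f => cmpm1 f;
     cmpm1 := fun x y f => cmp1m f;
     cmpA := fun x y z w h g f => esym (cmpA f g h) |}.

Record Iso (C : Category) (x y : C) := MkIso {
  fwd : hom x y;
  bwd : hom y x;
  iso_bf : bwd ∘ fwd = idm x;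
  iso_fb : fwd ∘ bwd = idm y }.

Definition iso_id (C : Category) (x : C) : Iso x x :=
  MkIso (cmp1m (idm x)) (cmp1m (idm x)).

Definition iso_inv (C : Category) (x y : C) (i : Iso x y) : Iso y x :=
  MkIso (iso_fb i) (iso_bf i).

Definition eq_hom (C : Category) (x y : C) (e : x = y) : hom x y :=
  match e in _ = z return hom x z with erefl => idm x end.

Record Functor (C D : Category) := MkFunctor {
  fob :> C -> D;
  fmap : forall x y, hom x y -> hom (fob x) (fob y);
  fmap1 : forall x, fmap (idm x) = idm (fob x);
  fmapM : forall x y z (g : hom y z) (f : hom x y),
      fmap (g ∘ f) = fmap g ∘ fmap f }.

Arguments fmap {C D} F {x y} f : rename.

Definition Fid (C : Category) : Functor C C :=
  @MkFunctor C C (fun x => x) (fun x y f => f) (fun _ => erefl)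
    (fun _ _ _ _ _ => erefl).

Lemma fcomp_id (C D E : Category) (G : Functor D E) (F : Functor C D) x :
  fmap G (fmap F (idm x)) = idm (G (F x)).
Proof. by rewrite !fmap1. Qed.

Lemma fcomp_cmp (C D E : Category) (G : Functor D E) (F : Functor C D)
    x y z (g : hom y z) (f : hom x y) :
  fmap G (fmap F (g ∘ f)) = fmap G (fmap F g) ∘ fmap G (fmap F f).
Proof. by rewrite !fmapM. Qed.

Definition Fcomp (C D E : Category) (G : Functor D E) (F : Functor C D) :
    Functor C E :=
  @MkFunctor C E (fun x => G (F x)) (fun x y f => fmap G (fmap F f))
    (fcomp_id G F) (fcomp_cmp G F).

Fixpoint Fiter (C : Category) (T : Functor C C) (m : nat) : Functor C C :=
  if m is k.+1 then Fcomp T (Fiter T k) else Fid C.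

Record NatTrans (C D : Category) (F G : Functor C D) := MkNatTrans {
  nt :> forall x, hom (F x) (G x);
  ntN : forall x y (f : hom x y), fmap G f ∘ nt x = nt y ∘ fmap F f }.

Lemma nt_eq (C D : Category) (F G : Functor C D) (a b : NatTrans F G) :
  (forall x, a x = b x) -> a = b.
Proof.
case: a b => [a aN] [b bN] /= ab.
have {}ab : a = b by apply: functional_extensionality_dep.
by subst b; congr MkNatTrans; apply: proof_irrelevance.
Qed.

Lemma ntid_nat (C D : Category) (F : Functor C D) x y (f : hom x y) :
  fmap F f ∘ idm (F x) = idm (F y) ∘ fmap F f.
Proof. by rewrite cmp1m cmpm1. Qed.

Definition nt_id (C D : Category) (F : Functor C D) : NatTrans F F :=
  @MkNatTrans C D F F (fun x => idm (F x)) (@ntid_nat C D F).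

Lemma ntcmp_nat (C D : Category) (F G H : Functor C D)
    (b : NatTrans G H) (a : NatTrans F G) x y (f : hom x y) :
  fmap H f ∘ (b x ∘ a x) = (b y ∘ a y) ∘ fmap F f.
Proof. by rewrite cmpA ntN -cmpA ntN cmpA. Qed.

Definition nt_cmp (C D : Category) (F G H : Functor C D)
    (b : NatTrans G H) (a : NatTrans F G) : NatTrans F H :=
  MkNatTrans (ntcmp_nat b a).

Definition FunCat (C D : Category) : Category.
Proof.
refine (@MkCategory (Functor C D) (@NatTrans C D) (@nt_id C D) (@nt_cmp C D)
          _ _ _).
- by move=> F G a; apply: nt_eq => x; apply: cmp1m.
- by move=> F G a; apply: nt_eq => x; apply: cmpm1.
- by move=> F G H K c b a; apply: nt_eq => x; apply: cmpA.
Defined.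

Lemma hcmp_nat (C D E : Category) (G G' : Functor D E) (F F' : Functor C D)
    (b : NatTrans G G') (a : NatTrans F F') x y (f : hom x y) :
  fmap (Fcomp G' F') f ∘ (b (F' x) ∘ fmap G (a x)) =
  (b (F' y) ∘ fmap G (a y)) ∘ fmap (Fcomp G F) f.
Proof. by rewrite /= cmpA ntN -!cmpA -!fmapM ntN. Qed.

Definition nt_hcmp (C D E : Category) (G G' : Functor D E) (F F' : Functor C D)
    (b : NatTrans G G') (a : NatTrans F F') :
    NatTrans (Fcomp G F) (Fcomp G' F') :=
  @MkNatTrans C E (Fcomp G F) (Fcomp G' F')
    (fun x => b (F' x) ∘ fmap G (a x)) (hcmp_nat b a).

Record Bicategory := MkBicategory {
  bob :> Type;
  bhom : bob -> bob -> Category;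
  b1 : forall a, bhom a a;
  bcmp : forall a b c, bhom b c -> bhom a b -> bhom a c;
  bhcmp : forall a b c (g g' : bhom b c) (f f' : bhom a b),
      hom g g' -> hom f f' -> hom (bcmp g f) (bcmp g' f');
  bassoc : forall a b c d (h : bhom c d) (g : bhom b c) (f : bhom a b),
      Iso (bcmp h (bcmp g f)) (bcmp (bcmp h g) f);
  blun : forall a b (f : bhom a b), Iso (bcmp (b1 b) f) f;
  brun : forall a b (f : bhom a b), Iso (bcmp f (b1 a)) f;
  bhcmp1 : forall a b c (g : bhom b c) (f : bhom a b),
      bhcmp (idm g) (idm f) = idm (bcmp g f);
  bhcmpM : forall a b c (g g' g'' : bhom b c) (f f' f'' : bhom a b)
      (v' : hom g' g'') (v : hom g g') (u' : hom f' f'') (u : hom f f'),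
      bhcmp (v' ∘ v) (u' ∘ u) = bhcmp v' u' ∘ bhcmp v u;
  bassocN : forall a b c d (h h' : bhom c d) (g g' : bhom b c)
      (f f' : bhom a b) (w : hom h h') (v : hom g g') (u : hom f f'),
      bhcmp (bhcmp w v) u ∘ fwd (bassoc h g f) =
      fwd (bassoc h' g' f') ∘ bhcmp w (bhcmp v u);
  blunN : forall a b (f f' : bhom a b) (u : hom f f'),
      u ∘ fwd (blun f) = fwd (blun f') ∘ bhcmp (idm (b1 b)) u;
  brunN : forall a b (f f' : bhom a b) (u : hom f f'),
      u ∘ fwd (brun f) = fwd (brun f') ∘ bhcmp u (idm (b1 a));
  bpentagon : forall a b c d e (k : bhom d e) (h : bhom c d) (g : bhom b c)
      (f : bhom a b),
      fwd (bassoc (bcmp k h) g f) ∘ fwd (bassoc k h (bcmp g f)) =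
      bhcmp (fwd (bassoc k h g)) (idm f) ∘
        (fwd (bassoc k (bcmp h g) f) ∘ bhcmp (idm k) (fwd (bassoc h g f)));
  btriangle : forall a b c (g : bhom b c) (f : bhom a b),
      bhcmp (fwd (brun g)) (idm f) ∘ fwd (bassoc g (b1 b) f) =
      bhcmp (idm g) (fwd (blun f)) }.

Arguments bhom {b} x y : rename.
Arguments b1 {b} a : rename.
Arguments bcmp {b x y z} g f : rename.
Arguments bhcmp {b x y z g g' f f'} v u : rename.
Arguments bassoc {b x y z w} h g f : rename.
Arguments blun {b x y} f : rename.
Arguments brun {b x y} f : rename.

Notation "g ⊙ f" := (bcmp g f) (at level 40, left associativity) : cat_scope.
Notation "v ⋆ u" := (bhcmp v u) (at level 38, left associativity) : cat_scope.

(* Composition of functors is strictly associative and unital on objects and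
   morphisms, but not judgmentally so as records: the 2-category [Cat] is
   presented as a bicategory whose associators and unitors have identity
   components. *)
Lemma fcomp3_nat (A B C D : Category) (H : Functor C D) (G : Functor B C)
    (F : Functor A B) x y (f : hom x y) :
  fmap H (fmap G (fmap F f)) ∘ idm (H (G (F x))) =
  idm (H (G (F y))) ∘ fmap H (fmap G (fmap F f)).
Proof. by rewrite cmp1m cmpm1. Qed.

Definition cat_assoc (A B C D : Category) (H : Functor C D) (G : Functor B C)
    (F : Functor A B) :
    @Iso (FunCat A D) (Fcomp H (Fcomp G F)) (Fcomp (Fcomp H G) F).
Proof.
refine (@MkIso (FunCat A D) (Fcomp H (Fcomp G F)) (Fcomp (Fcomp H G) F)
  (@MkNatTrans A D (Fcomp H (Fcomp G F)) (Fcomp (Fcomp H G) F)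
     (fun x => idm (H (G (F x)))) (fcomp3_nat H G F))
  (@MkNatTrans A D (Fcomp (Fcomp H G) F) (Fcomp H (Fcomp G F))
     (fun x => idm (H (G (F x)))) (fcomp3_nat H G F)) _ _);
by apply: nt_eq => x; apply: cmp1m.
Defined.

Definition cat_lun (A B : Category) (F : Functor A B) :
    @Iso (FunCat A B) (Fcomp (Fid B) F) F.
Proof.
refine (@MkIso (FunCat A B) (Fcomp (Fid B) F) F
  (@MkNatTrans A B (Fcomp (Fid B) F) F (fun x => idm (F x)) (@ntid_nat A B F))
  (@MkNatTrans A B F (Fcomp (Fid B) F) (fun x => idm (F x)) (@ntid_nat A B F))
  _ _);
by apply: nt_eq => x; apply: cmp1m.
Defined.

Definition cat_run (A B : Category) (F : Functor A B) :
    @Iso (FunCat A B) (Fcomp F (Fid A)) F.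
Proof.
refine (@MkIso (FunCat A B) (Fcomp F (Fid A)) F
  (@MkNatTrans A B (Fcomp F (Fid A)) F (fun x => idm (F x)) (@ntid_nat A B F))
  (@MkNatTrans A B F (Fcomp F (Fid A)) (fun x => idm (F x)) (@ntid_nat A B F))
  _ _);
by apply: nt_eq => x; apply: cmp1m.
Defined.

Definition Cat : Bicategory.
Proof.
refine (@MkBicategory Category FunCat Fid Fcomp nt_hcmp cat_assoc cat_lun
          cat_run _ _ _ _ _ _ _).
- by move=> a b c G F; apply: nt_eq => x /=; rewrite fmap1 cmp1m.
- move=> a b c g g' g'' f f' f'' v' v u' u; apply: nt_eq => x /=.
  by rewrite fmapM -!cmpA; congr (_ ∘ _); rewrite !cmpA ntN.
- move=> a b c d h h' g g' f f' w v u; apply: nt_eq => x.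
  by rewrite /= /cat_assoc /= cmp1m cmpm1 fmapM cmpA.
- move=> a b f f' u; apply: nt_eq => x.
  by rewrite /= /cat_lun /= !cmp1m cmpm1.
- move=> a b f f' u; apply: nt_eq => x.
  by rewrite /= /cat_run /= fmap1 cmp1m !cmpm1 ?cmp1m.
- move=> a b c d e k h g f; apply: nt_eq => x.
  by rewrite /= /cat_assoc /= !fmap1 !cmp1m.
- move=> a b c g f; apply: nt_eq => x.
  by rewrite /= /cat_assoc /cat_run /cat_lun /= !fmap1 !cmp1m.
Defined.

(* The source is a category, seen as a locally discrete bicategory: its
   2-cells are equalities of morphisms, sent to the [eq_hom] of the induced
   equality of 1-cells.  Normalization: [pf_id] is an equality of 1-cells and
   the unit constraint is the identity 2-cell along it. *)
Record Pseudofunctor (C : Category) (B : Bicategory) := MkPseudofunctor {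
  pf_ob :> C -> B;
  pf_map : forall x y, hom x y -> bhom (pf_ob x) (pf_ob y);
  pf_cmp : forall x y z (g : hom y z) (f : hom x y),
      Iso (pf_map g ⊙ pf_map f) (pf_map (g ∘ f));
  pf_id : forall x, pf_map (idm x) = b1 (pf_ob x);
  pf_assoc : forall x y z w (h : hom z w) (g : hom y z) (f : hom x y),
      eq_hom (f_equal (@pf_map x w) (cmpA h g f)) ∘
        (fwd (pf_cmp h (g ∘ f)) ∘ (idm (pf_map h) ⋆ fwd (pf_cmp g f))) =
      fwd (pf_cmp (h ∘ g) f) ∘
        ((fwd (pf_cmp h g) ⋆ idm (pf_map f)) ∘
           fwd (bassoc (pf_map h) (pf_map g) (pf_map f)));
  pf_unitl : forall x y (f : hom x y),
      eq_hom (f_equal (@pf_map x y) (cmp1m f)) ∘ fwd (pf_cmp (idm y) f) =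
      fwd (blun (pf_map f)) ∘ (eq_hom (pf_id y) ⋆ idm (pf_map f));
  pf_unitr : forall x y (f : hom x y),
      eq_hom (f_equal (@pf_map x y) (cmpm1 f)) ∘ fwd (pf_cmp f (idm x)) =
      fwd (brun (pf_map f)) ∘ (idm (pf_map f) ⋆ eq_hom (pf_id x)) }.

Arguments pf_map {C B} F {x y} f : rename.
Arguments pf_cmp {C B} F {x y z} g f : rename.
Arguments pf_id {C B} F x : rename.

(* Naturality of [s2] with respect to 2-cells of the locally discrete source
   holds automatically and is not repeated. *)
Record is_pseudonatural (C : Category) (B : Bicategory)
    (F G : Pseudofunctor C B) (s : forall x : C, bhom (F x) (G x))
    (s2 : forall (x y : C) (f : hom x y),
        Iso (s y ⊙ pf_map F f) (pf_map G f ⊙ s x)) : Prop := {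
  psn_id : forall x,
      (eq_hom (pf_id G x) ⋆ idm (s x)) ∘ fwd (s2 x x (idm x)) =
      bwd (blun (s x)) ∘
        (fwd (brun (s x)) ∘ (idm (s x) ⋆ eq_hom (pf_id F x)));
  psn_cmp : forall x y z (g : hom y z) (f : hom x y),
      fwd (s2 x z (g ∘ f)) ∘ (idm (s z) ⋆ fwd (pf_cmp F g f)) =
      (fwd (pf_cmp G g f) ⋆ idm (s x)) ∘
        (fwd (bassoc (pf_map G g) (pf_map G f) (s x)) ∘
        ((idm (pf_map G g) ⋆ fwd (s2 x y f)) ∘
        (bwd (bassoc (pf_map G g) (s y) (pf_map F f)) ∘
        ((fwd (s2 y z g) ⋆ idm (pf_map F f)) ∘
         fwd (bassoc (s z) (pf_map F g) (pf_map F f)))))) }.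

(* [(P, b, pi)] is the limit of [n] copies of [p : B -> A]; for [n = 0] this
   is the limit of the diagram consisting of [A] alone. *)
Definition is_power (D : Category) (A B : D) (p : hom B A) (n : nat) (P : D)
    (b : hom P A) (pi : 'I_n -> hom P B) : Prop :=
  (forall i, p ∘ pi i = b) /\
  forall (X : D) (a : hom X A) (f : 'I_n -> hom X B),
    (forall i, p ∘ f i = a) ->
    exists! u : hom X P, b ∘ u = a /\ forall i, pi i ∘ u = f i.

Definition is_equalizer (D : Category) (E X Y : D) (e : hom E X)
    (f g : hom X Y) : Prop :=
  f ∘ e = g ∘ e /\
  forall (Z : D) (h : hom Z X), f ∘ h = g ∘ h ->
    exists! u : hom Z E, e ∘ u = h.

Record Power (D : Category) (A B : D) (p : hom B A) (n : nat) := MkPower {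
  pow_ob :> D;
  pow_base : hom pow_ob A;
  pow_proj : 'I_n -> hom pow_ob B;
  pow_lim : is_power p pow_base pow_proj }.

Arguments pow_base {D A B p n} P : rename.
Arguments pow_proj {D A B p n} P i : rename.

(* [is_pair pi u f g]: [u] is the morphism [<f, g>] into a 2-fold power with
   projections [pi]; it is unique when the power is a limit. *)
Definition is_pair (D : Category) (X P B : D) (pi : 'I_2 -> hom P B)
    (u : hom X P) (f g : hom X B) : Prop :=
  pi ord0 ∘ u = f /\ pi ord_max ∘ u = g.

Definition power_tuple (D : Category) (A B : D) (p : hom B A) n
    (P : Power p n) (X : D) (a : hom X A) (f : 'I_n -> hom X B)
    (e : forall i, p ∘ f i = a) :
    {u : hom X P | pow_base P ∘ u = a /\ forall i, pow_proj P i ∘ u = f i} :=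
  constructive_definite_description _ (proj2 (pow_lim P) X a f e).

Lemma power_inj (D : Category) (A B : D) (p : hom B A) n (P : D)
    (b : hom P A) (pi : 'I_n -> hom P B) (X : D) (u v : hom X P) :
  is_power p b pi -> b ∘ u = b ∘ v -> (forall i, pi i ∘ u = pi i ∘ v) -> u = v.
Proof.
move=> [pib lim] ub upi.
have [|w [_ wu]] := lim X (b ∘ u) (fun i => pi i ∘ u).
  by move=> i; rewrite cmpA pib.
rewrite -(wu u); last by split.
by apply: wu; split=> [|i]; rewrite ?ub ?upi.
Qed.

(* [(add, zero)] makes [p : B -> A] a commutative monoid in the slice over
   [A], whose binary and ternary products are the powers [P2] and [P3]. *)
Record is_comm_monoid_over (D : Category) (A B : D) (p : hom B A)
    (P2 : Power p 2) (P3 : Power p 3) (add : hom P2 B) (zero : hom A B) :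
    Prop := {
  add_over : p ∘ add = pow_base P2;
  zero_over : p ∘ zero = idm A;
  add_zerol : forall u : hom B P2,
      is_pair (pow_proj P2) u (zero ∘ p) (idm B) -> add ∘ u = idm B;
  add_comm : forall u : hom P2 P2,
      is_pair (pow_proj P2) u (pow_proj P2 ord_max) (pow_proj P2 ord0) ->
      add ∘ u = add;
  add_assoc : forall u v s t : hom P3 P2,
      let pi0 := pow_proj P3 ord0 in
      let pi1 := pow_proj P3 (@Ordinal 3 1 isT) in
      let pi2 := pow_proj P3 ord_max in
      is_pair (pow_proj P2) u pi0 pi1 ->
      is_pair (pow_proj P2) v pi1 pi2 ->
      is_pair (pow_proj P2) s (add ∘ u) pi2 ->
      is_pair (pow_proj P2) t pi0 (add ∘ v) ->
      add ∘ s = add ∘ t }.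

Arguments is_comm_monoid_over {D A B p} P2 P3 add zero.

Section PowerFunctor.

Variables (D : Category) (T : Functor D D) (p : NatTrans T (Fid D)) (n : nat).
Variable P : forall A, Power (p A) n.

Lemma Tpow_compat A B (f : hom A B) i :
  p B ∘ (fmap T f ∘ pow_proj (P A) i) = f ∘ pow_base (P A).
Proof. by rewrite cmpA -ntN -cmpA (proj1 (pow_lim (P A)) i). Qed.

Definition Tpow_map A B (f : hom A B) : hom (P A) (P B) :=
  sval (power_tuple (P B) (Tpow_compat f)).

Lemma Tpow_base A B (f : hom A B) :
  pow_base (P B) ∘ Tpow_map f = f ∘ pow_base (P A).
Proof. by rewrite /Tpow_map; case: power_tuple => u [] /=. Qed.

Lemma Tpow_proj A B (f : hom A B) i :
  pow_proj (P B) i ∘ Tpow_map f = fmap T f ∘ pow_proj (P A) i.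
Proof. by rewrite /Tpow_map; case: power_tuple => u [] /=. Qed.

Lemma Tpow_id A : Tpow_map (idm A) = idm (P A : D).
Proof.
apply: (power_inj (pow_lim (P A))) => [|i].
  by rewrite Tpow_base cmp1m cmpm1.
by rewrite Tpow_proj fmap1 cmp1m cmpm1.
Qed.

Lemma Tpow_cmp A B E (g : hom B E) (f : hom A B) :
  Tpow_map (g ∘ f) = Tpow_map g ∘ Tpow_map f.
Proof.
apply: (power_inj (pow_lim (P E))) => [|i].
  by rewrite cmpA !Tpow_base -!cmpA Tpow_base.
by rewrite cmpA !Tpow_proj -!cmpA Tpow_proj fmapM cmpA.
Qed.

Definition Tpow : Functor D D :=
  @MkFunctor D D (fun A => pow_ob (P A)) Tpow_map Tpow_id Tpow_cmp.

End PowerFunctor.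

(* A tangent structure only asserts that the pullback powers exist; the
   functor [T_2] in the type of the addition refers to a choice of them, made
   here once and for all, so that the data below is the tuple
   [(T, p, 0, +, l, c)]. *)
Definition some_power (D : Category) (A B : D) (p : hom B A) n
    (e : inhabited (Power p n)) : Power p n :=
  epsilon e (fun _ => True).

Record TangentData (D : Category) := MkTangentData {
  tT :> Functor D D;
  tp : NatTrans tT (Fid D);
  tz : NatTrans (Fid D) tT;
  tn_ex : forall (n : nat) (A : D), inhabited (Power (tp A) n);
  ta : NatTrans (Tpow (fun A => some_power (tn_ex 2 A))) tT;
  tl : NatTrans tT (Fcomp tT tT);
  tc : NatTrans (Fcomp tT tT) (Fcomp tT tT) }.

Arguments tp {D} T : rename.
Arguments tz {D} T : rename.
Arguments tn_ex {D} T n A : rename.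
Arguments ta {D} T : rename.
Arguments tl {D} T : rename.
Arguments tc {D} T : rename.

Definition tn (D : Category) (T : TangentData D) (n : nat) (A : D) :
    Power (tp T A) n :=
  some_power (tn_ex T n A).

(* A morphism [<f, g>] into a pullback power is quantified over as [u] with
   [is_pair _ u f g]. *)
Record is_tangent (D : Category) (T : TangentData D) : Prop := {
  tn_pres : forall (m n : nat) (A : D),
      is_power (fmap (Fiter T m) (tp T A))
        (fmap (Fiter T m) (pow_base (tn T n A)))
        (fun i => fmap (Fiter T m) (pow_proj (tn T n A) i));
  ta_monoid : forall A : D,
      is_comm_monoid_over (tn T 2 A) (tn T 3 A) (ta T A) (tz T A);
  tl_p : forall A : D, fmap T (tp T A) ∘ tl T A = tz T A ∘ tp T A;
  tl_add : forall (A : D) (u : hom (tn T 2 A : D) (T (tn T 2 A))),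
      is_pair (fun i => fmap T (pow_proj (tn T 2 A) i)) u
        (tl T A ∘ pow_proj (tn T 2 A) ord0)
        (tl T A ∘ pow_proj (tn T 2 A) ord_max) ->
      tl T A ∘ ta T A = fmap T (ta T A) ∘ u;
  tl_zero : forall A : D, tl T A ∘ tz T A = fmap T (tz T A) ∘ tz T A;
  tc_p : forall A : D, tp T (T A) ∘ tc T A = fmap T (tp T A);
  tc_add : forall (A : D) (u : hom (T (tn T 2 A)) (tn T 2 (T A))),
      is_pair (pow_proj (tn T 2 (T A))) u
        (tc T A ∘ fmap T (pow_proj (tn T 2 A) ord0))
        (tc T A ∘ fmap T (pow_proj (tn T 2 A) ord_max)) ->
      tc T A ∘ fmap T (ta T A) = ta T (T A) ∘ u;
  tc_zero : forall A : D, tc T A ∘ fmap T (tz T A) = tz T (T A);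
  tc_invol : forall A : D, tc T A ∘ tc T A = idm (T (T A));
  tc_l : forall A : D, tc T A ∘ tl T A = tl T A;
  tl_coassoc : forall A : D, fmap T (tl T A) ∘ tl T A = tl T (T A) ∘ tl T A;
  tc_braid : forall A : D,
      tc T (T A) ∘ fmap T (tc T A) ∘ tc T (T A) =
      fmap T (tc T A) ∘ tc T (T A) ∘ fmap T (tc T A);
  tc_tl : forall A : D,
      tc T (T A) ∘ fmap T (tc T A) ∘ tl T (T A) = fmap T (tl T A) ∘ tc T A;
  t_univ : forall (A : D) (u : hom (tn T 2 A : D) (T (tn T 2 A))),
      is_pair (fun i => fmap T (pow_proj (tn T 2 A) i)) u
        (tl T A ∘ pow_proj (tn T 2 A) ord0)
        (tz T (T A) ∘ pow_proj (tn T 2 A) ord_max) ->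
      is_equalizer (fmap T (ta T A) ∘ u)
        (fmap T (tp T A)) (tz T A ∘ tp T A ∘ tp T (T A)) }.

Record TangentStructure (D : Category) := MkTangentStructure {
  tdata :> TangentData D;
  tlaws : is_tangent tdata }.

Record is_strong_tangent (D E : Category) (T : TangentStructure D)
    (S : TangentStructure E) (H : Functor D E)
    (al : @Iso (FunCat D E) (Fcomp H T) (Fcomp S H)) : Prop := {
  st_pow : forall (n : nat) (A : D),
      is_power (fmap H (tp T A)) (fmap H (pow_base (tn T n A)))
        (fun i => fmap H (pow_proj (tn T n A) i));
  st_eqz : forall (A : D) (u : hom (tn T 2 A : D) (T (tn T 2 A))),
      is_pair (fun i => fmap T (pow_proj (tn T 2 A) i)) u
        (tl T A ∘ pow_proj (tn T 2 A) ord0)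
        (tz T (T A) ∘ pow_proj (tn T 2 A) ord_max) ->
      is_equalizer (fmap H (fmap T (ta T A) ∘ u))
        (fmap H (fmap T (tp T A))) (fmap H (tz T A ∘ tp T A ∘ tp T (T A)));
  st_p : forall A : D, tp S (H A) ∘ fwd al A = fmap H (tp T A);
  st_z : forall A : D, fwd al A ∘ fmap H (tz T A) = tz S (H A);
  st_a : forall (A : D) (u : hom (H (tn T 2 A)) (tn S 2 (H A))),
      is_pair (pow_proj (tn S 2 (H A))) u
        (fwd al A ∘ fmap H (pow_proj (tn T 2 A) ord0))
        (fwd al A ∘ fmap H (pow_proj (tn T 2 A) ord_max)) ->
      fwd al A ∘ fmap H (ta T A) = ta S (H A) ∘ u;
  st_l : forall A : D,
      tl S (H A) ∘ fwd al A =
      fmap S (fwd al A) ∘ fwd al (T A) ∘ fmap H (tl T A);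
  st_c : forall A : D,
      tc S (H A) ∘ fmap S (fwd al A) ∘ fwd al (T A) =
      fmap S (fwd al A) ∘ fwd al (T A) ∘ fmap H (tc T A) }.

Record TanCat := MkTanCat {
  tcat :> Category;
  tstr : TangentStructure tcat }.

Record TanMor (X Y : TanCat) := MkTanMor {
  tm_fun :> Functor X Y;
  tm_dist : @Iso (FunCat X Y) (Fcomp tm_fun (tstr X)) (Fcomp (tstr Y) tm_fun);
  tm_strong : is_strong_tangent tm_dist }.

Record Tan2 (X Y : TanCat) (H K : TanMor X Y) := MkTan2 {
  t2 :> NatTrans H K;
  t2_dist : forall A : X,
      fmap (tstr Y) (t2 A) ∘ fwd (tm_dist H) A =
      fwd (tm_dist K) A ∘ t2 (tstr X A) }.

Section Transport.

Variables (D E : Category) (G : Functor D E).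

Lemma power_transport (A B B' : D) (p : hom B A) (q : hom B' A)
    (phi : hom B B') (psi : hom B' B) n
    (P P' : D) (b : hom P A) (b' : hom P' A)
    (pi : 'I_n -> hom P B) (pi' : 'I_n -> hom P' B') :
  psi ∘ phi = idm B -> phi ∘ psi = idm B' -> q ∘ phi = p ->
  is_power p b pi -> is_power q b' pi' ->
  is_power (fmap G q) (fmap G b') (fun i => fmap G (pi' i)) ->
  is_power (fmap G p) (fmap G b) (fun i => fmap G (pi i)).
Proof.
move=> sf fs qf Pp Pq GP.
have ps : p ∘ psi = q by rewrite -qf -cmpA fs cmpm1.
have [|k [[bk pik] _]] := proj2 Pq P b (fun i => phi ∘ pi i).
  by move=> i; rewrite cmpA qf (proj1 Pp).
have [|j [[bj pij] _]] := proj2 Pp P' b' (fun i => psi ∘ pi' i).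
  by move=> i; rewrite cmpA ps (proj1 Pq).
have jk : j ∘ k = idm P.
  apply: (power_inj Pp) => [|i]; rewrite cmpA cmpm1.
    by rewrite bj bk.
  by rewrite pij -cmpA pik cmpA sf cmp1m.
have kj : k ∘ j = idm P'.
  apply: (power_inj Pq) => [|i]; rewrite cmpA cmpm1.
    by rewrite bk bj.
  by rewrite pik -cmpA pij cmpA fs cmp1m.
split=> [i|X a f pf]; first by rewrite -fmapM (proj1 Pp).
have [|w [[bw piw] wu]] := proj2 GP X a (fun i => fmap G phi ∘ f i).
  by move=> i; rewrite cmpA -fmapM qf pf.
exists (fmap G j ∘ w); split; first split=> [|i].
- by rewrite cmpA -fmapM bj bw.
- by rewrite cmpA -fmapM pij fmapM -cmpA piw cmpA -fmapM sf fmap1 cmp1m.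
move=> v [bv piv]; rewrite (wu (fmap G k ∘ v)).
  by rewrite cmpA -fmapM jk fmap1 cmp1m.
split=> [|i]; first by rewrite cmpA -fmapM bk bv.
by rewrite cmpA -fmapM pik fmapM -cmpA piv.
Qed.

Lemma equalizer_inj (K X Y Z : D) (e : hom K X) (f g : hom X Y)
    (u v : hom Z K) :
  is_equalizer e f g -> e ∘ u = e ∘ v -> u = v.
Proof.
move=> [fg lim] uv; have [|w [_ wu]] := lim Z (e ∘ u).
  by rewrite !cmpA fg.
by rewrite -(wu u) // -(wu v).
Qed.

Lemma equalizer_transport (K K' X X' Y Y' : D) (e : hom K X) (f g : hom X Y)
    (e' : hom K' X') (f' g' : hom X' Y')
    (phi : hom X X') (psi : hom X' X) (th : hom Y Y') (ht : hom Y' Y) :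
  psi ∘ phi = idm X -> phi ∘ psi = idm X' -> ht ∘ th = idm Y ->
  f' ∘ phi = th ∘ f -> g' ∘ phi = th ∘ g ->
  is_equalizer e f g -> is_equalizer e' f' g' ->
  is_equalizer (fmap G e') (fmap G f') (fmap G g') ->
  is_equalizer (fmap G e) (fmap G f) (fmap G g).
Proof.
move=> sf fs tt ff gg Ee Ee' GE.
have f_psi : f ∘ psi = ht ∘ f'.
  by rewrite -[f in LHS]cmp1m -tt -(cmpA ht) -ff -!cmpA fs cmpm1.
have g_psi : g ∘ psi = ht ∘ g'.
  by rewrite -[g in LHS]cmp1m -tt -(cmpA ht) -gg -!cmpA fs cmpm1.
have [|k [ek _]] := proj2 Ee' K (phi ∘ e).
  by rewrite !cmpA ff gg -!cmpA (proj1 Ee).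
have [|j [ej _]] := proj2 Ee K' (psi ∘ e').
  by rewrite !cmpA f_psi g_psi -!cmpA (proj1 Ee').
have jk : j ∘ k = idm K.
  apply: (equalizer_inj Ee).
  by rewrite cmpA ej -cmpA ek cmpA sf cmp1m cmpm1.
have kj : k ∘ j = idm K'.
  apply: (equalizer_inj Ee').
  by rewrite cmpA ek -cmpA ej cmpA fs cmp1m cmpm1.
split=> [|Z h fgh]; first by rewrite -!fmapM (proj1 Ee).
have [|w [ew wu]] := proj2 GE Z (fmap G phi ∘ h).
  by rewrite !cmpA -!fmapM ff gg !fmapM -!cmpA fgh.
exists (fmap G j ∘ w); split.
  by rewrite cmpA -fmapM ej fmapM -cmpA ew cmpA -fmapM sf fmap1 cmp1m.
move=> v ev; rewrite (wu (fmap G k ∘ v)).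
  by rewrite cmpA -fmapM jk fmap1 cmp1m.
by rewrite cmpA -fmapM ek fmapM -cmpA ev.
Qed.

End Transport.

Lemma nt_bf (C D : Category) (F G : Functor C D) (i : @Iso (FunCat C D) F G) x :
  bwd i x ∘ fwd i x = idm (F x).
Proof. exact: (f_equal (fun t : NatTrans F F => t x) (iso_bf i)). Qed.

Lemma nt_fb (C D : Category) (F G : Functor C D) (i : @Iso (FunCat C D) F G) x :
  fwd i x ∘ bwd i x = idm (G x).
Proof. exact: (f_equal (fun t : NatTrans G G => t x) (iso_fb i)). Qed.

Definition tm_id_dist (X : TanCat) :
    @Iso (FunCat X X) (Fcomp (Fid X) (tstr X)) (Fcomp (tstr X) (Fid X)).
Proof.
refine (@MkIso (FunCat X X) (Fcomp (Fid X) (tstr X)) (Fcomp (tstr X) (Fid X))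
  (@MkNatTrans X X (Fcomp (Fid X) (tstr X)) (Fcomp (tstr X) (Fid X))
     (fun A => idm (tstr X A)) (@ntid_nat X X (tstr X)))
  (@MkNatTrans X X (Fcomp (tstr X) (Fid X)) (Fcomp (Fid X) (tstr X))
     (fun A => idm (tstr X A)) (@ntid_nat X X (tstr X))) _ _);
by apply: nt_eq => A; apply: cmp1m.
Defined.

Lemma tm_id_strong (X : TanCat) : is_strong_tangent (tm_id_dist X).
Proof.
split=> /=.
- by move=> n A; apply: pow_lim.
- by move=> A u; apply: (t_univ (tlaws (tstr X))).
- by move=> A; rewrite cmpm1.
- by move=> A; rewrite cmp1m.
- move=> A u [u0 u1]; rewrite cmp1m.
  suff -> : u = idm _ by rewrite cmpm1.
  have Pl := pow_lim (tn (tstr X) 2 A).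
  have upi (i : 'I_2) : pow_proj (tn (tstr X) 2 A) i ∘ u =
      pow_proj (tn (tstr X) 2 A) i ∘ idm _.
    rewrite cmpm1; case: i => [[|[|//]] i2].
      rewrite (_ : Ordinal i2 = ord0); last exact: val_inj.
      by rewrite u0 cmp1m.
    rewrite (_ : Ordinal i2 = ord_max); last exact: val_inj.
    by rewrite u1 cmp1m.
  apply: (power_inj Pl) => //.
  by rewrite -(proj1 Pl ord0) -!cmpA upi.
- by move=> A; rewrite fmap1 !cmp1m cmpm1.
- by move=> A; rewrite !fmap1 !cmp1m !cmpm1.
Qed.

Definition tm_id (X : TanCat) : TanMor X X := MkTanMor (tm_id_strong X).

Lemma tm_bf (U V : TanCat) (F : TanMor U V) A :
  bwd (tm_dist F) A ∘ fwd (tm_dist F) A = idm (F (tstr U A)).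
Proof. exact: (nt_bf (tm_dist F)). Qed.

Lemma tm_fb (U V : TanCat) (F : TanMor U V) A :
  fwd (tm_dist F) A ∘ bwd (tm_dist F) A = idm (tstr V (F A)).
Proof. exact: (nt_fb (tm_dist F)). Qed.

Section TanComp.

Variables (X Y Z : TanCat) (G : TanMor Y Z) (H : TanMor X Y).

Let T := tstr X.
Let S := tstr Y.
Let R := tstr Z.
Let al := tm_dist H.
Let be := tm_dist G.

Lemma tm_cmp_fwd_nat A B (f : hom A B) :
  fmap R (fmap G (fmap H f)) ∘ (fwd be (H A) ∘ fmap G (fwd al A)) =
  (fwd be (H B) ∘ fmap G (fwd al B)) ∘ fmap G (fmap H (fmap T f)).
Proof.
have aN : fmap S (fmap H f) ∘ fwd al A = fwd al B ∘ fmap H (fmap T f) :=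
  ntN (fwd al) f.
have bN : fmap R (fmap G (fmap H f)) ∘ fwd be (H A) =
    fwd be (H B) ∘ fmap G (fmap S (fmap H f)) := ntN (fwd be) (fmap H f).
by rewrite cmpA bN -!cmpA -!fmapM aN.
Qed.

Lemma tm_cmp_bwd_nat A B (f : hom A B) :
  fmap G (fmap H (fmap T f)) ∘ (fmap G (bwd al A) ∘ bwd be (H A)) =
  (fmap G (bwd al B) ∘ bwd be (H B)) ∘ fmap R (fmap G (fmap H f)).
Proof.
have aN : fmap H (fmap T f) ∘ bwd al A = bwd al B ∘ fmap S (fmap H f) :=
  ntN (bwd al) f.
have bN : fmap G (fmap S (fmap H f)) ∘ bwd be (H A) =
    bwd be (H B) ∘ fmap R (fmap G (fmap H f)) := ntN (bwd be) (fmap H f).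
by rewrite -cmpA -bN !cmpA -!fmapM aN.
Qed.

Definition tm_cmp_dist :
    @Iso (FunCat X Z) (Fcomp (Fcomp G H) T) (Fcomp R (Fcomp G H)).
Proof.
refine (@MkIso (FunCat X Z) (Fcomp (Fcomp G H) T) (Fcomp R (Fcomp G H))
  (@MkNatTrans X Z (Fcomp (Fcomp G H) T) (Fcomp R (Fcomp G H))
     (fun A => fwd be (H A) ∘ fmap G (fwd al A)) tm_cmp_fwd_nat)
  (@MkNatTrans X Z (Fcomp R (Fcomp G H)) (Fcomp (Fcomp G H) T)
     (fun A => fmap G (bwd al A) ∘ bwd be (H A)) tm_cmp_bwd_nat) _ _);
apply: nt_eq => A /=.
- have E1 : fmap G (bwd al A) ∘ fmap G (fwd al A) = idm (G (H (T A))).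
    by rewrite -fmapM tm_bf fmap1.
  have E2 := tm_bf G (H A).
  by rewrite cmpA -(cmpA _ (bwd be _)) E2 cmpm1 E1.
- have E1 : fmap G (fwd al A) ∘ fmap G (bwd al A) = idm (G (S (H A))).
    by rewrite -fmapM tm_fb fmap1.
  have E2 := tm_fb G (H A).
  by rewrite cmpA -(cmpA _ (fmap G (fwd al A))) E1 cmpm1 E2.
Defined.

Lemma tm_cmp_strong : is_strong_tangent tm_cmp_dist.
Proof.
have sH := tm_strong H; have sG := tm_strong G.
split.
- move=> n A; apply: (power_transport (tm_bf H A) (tm_fb H A) (st_p sH A)).
  + exact: (st_pow sH).
  + exact: (pow_lim (tn S n (H A))).
  + exact: (st_pow sG).
- move=> A u uP.
  have [|e' [[_ e'P] _]] := proj2 (tn_pres (tlaws S) 1 2 (H A))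
     (tn S 2 (H A)) (tz S (H A) ∘ pow_base (tn S 2 (H A)))
     (fun i => if val i == 0 then tl S (H A) ∘ pow_proj (tn S 2 (H A)) ord0
               else tz S (S (H A)) ∘ pow_proj (tn S 2 (H A)) ord_max).
    move=> i /=; case: ifP => _; rewrite cmpA.
      by rewrite (tl_p (tlaws S)) -cmpA (proj1 (pow_lim _)).
    by rewrite (ntN (tz S) (tp S (H A))) -cmpA /= (proj1 (pow_lim _)).
  have e'2 : is_pair (fun i => fmap S (pow_proj (tn S 2 (H A)) i)) e'
     (tl S (H A) ∘ pow_proj (tn S 2 (H A)) ord0)
     (tz S (S (H A)) ∘ pow_proj (tn S 2 (H A)) ord_max).
    by split; [exact: (e'P ord0)|exact: (e'P ord_max)].
  have qa (B : X) : tp S (H B) ∘ fwd al B = fmap H (tp T B) := st_p sH B.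
  have az (B : X) : fwd al B ∘ fmap H (tz T B) = tz S (H B) := st_z sH B.
  have al_bf (B : X) : bwd al B ∘ fwd al B = idm (H (T B)) := tm_bf H B.
  have al_fb (B : X) : fwd al B ∘ bwd al B = idm (S (H B)) := tm_fb H B.
  have Sbf (B : X) : fmap S (bwd al B) ∘ fmap S (fwd al B) = idm (S (H (T B))).
    by rewrite -fmapM al_bf fmap1.
  have Sfb (B : X) : fmap S (fwd al B) ∘ fmap S (bwd al B) = idm (S (S (H B))).
    by rewrite -fmapM al_fb fmap1.
  apply: (equalizer_transport
    (phi := fmap S (fwd al A) ∘ fwd al (T A))
    (psi := bwd al (T A) ∘ fmap S (bwd al A))
    (th := fwd al A) (ht := bwd al A) (f' := fmap S (tp S (H A)))
    (g' := tz S (H A) ∘ tp S (H A) ∘ tp S (S (H A))) _ _ _ _ _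
    (st_eqz sH uP) (t_univ (tlaws S) e'2) (st_eqz sG e'2)).
  + by rewrite cmpA -(cmpA _ (fmap S (bwd al A))) Sbf cmpm1 al_bf.
  + by rewrite cmpA -(cmpA _ (fwd al (T A))) al_fb cmpm1 Sfb.
  + exact: al_bf.
  + by rewrite cmpA -fmapM qa (ntN (fwd al) (tp T A)).
  + rewrite !fmapM !cmpA az -!cmpA; congr (_ ∘ _).
    have /= := ntN (tp S) (fwd al A); rewrite (cmpA (tp S (S _))) => <-.
    by rewrite -cmpA qa cmpA qa.
- by move=> A /=; rewrite cmpA (st_p sG) -fmapM (st_p sH).
- by move=> A /=; rewrite -cmpA -fmapM (st_z sH) (st_z sG).
- move=> A u [u0 u1] /=.
  have [|k [[_ kP] _]] := proj2 (pow_lim (tn S 2 (H A))) (H (tn T 2 A))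
     (fmap H (pow_base (tn T 2 A)))
     (fun i => fwd al A ∘ fmap H (pow_proj (tn T 2 A) i)).
    by move=> i; rewrite cmpA (st_p sH) -fmapM (proj1 (pow_lim _)).
  have [|j [[_ jP] _]] := proj2 (pow_lim (tn R 2 (G (H A)))) (G (tn S 2 (H A)))
     (fmap G (pow_base (tn S 2 (H A))))
     (fun i => fwd be (H A) ∘ fmap G (pow_proj (tn S 2 (H A)) i)).
    by move=> i; rewrite cmpA (st_p sG) -fmapM (proj1 (pow_lim _)).
  rewrite -cmpA -fmapM (st_a sH (u := k)); last by split; apply: kP.
  rewrite fmapM cmpA (st_a sG (u := j)); last by split; apply: jP.
  rewrite -cmpA; congr (_ ∘ _).
  have Pl := pow_lim (tn R 2 (G (H A))).
  have upi (i : 'I_2) : pow_proj (tn R 2 (G (H A))) i ∘ (j ∘ fmap G k) =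
      pow_proj (tn R 2 (G (H A))) i ∘ u.
    rewrite cmpA jP -cmpA -fmapM kP fmapM cmpA.
    case: i => [[|[|//]] i2].
      by rewrite (_ : Ordinal i2 = ord0); [rewrite u0|exact: val_inj].
    by rewrite (_ : Ordinal i2 = ord_max); [rewrite u1|exact: val_inj].
  apply: (power_inj Pl) => //.
  by rewrite -(proj1 Pl ord0) -!cmpA upi.
- move=> A /=; rewrite cmpA (st_l sG) -!cmpA -fmapM (st_l sH) !fmapM.
  rewrite -!cmpA; congr (_ ∘ _); rewrite !cmpA; congr (_ ∘ _); congr (_ ∘ _).
  by rewrite (ntN (fwd be) (fwd al A)).
- move=> A /=.
  have bN : fmap R (fmap G (fwd al A)) ∘ fwd be (H (T A)) =
      fwd be (S (H A)) ∘ fmap G (fmap S (fwd al A)) := ntN (fwd be) (fwd al A).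
  have E1 := st_c sG (H A); have := f_equal (fmap G) (st_c sH A).
  rewrite !fmapM -!cmpA => E2.
  rewrite !cmpA -(cmpA _ (fmap R (fmap G (fwd al A)))) bN cmpA E1.
  rewrite -!cmpA E2 !cmpA -(cmpA _ (fmap R (fmap G (fwd al A)))) bN.
  by rewrite !cmpA.
Qed.

Definition tm_cmp : TanMor X Z := MkTanMor tm_cmp_strong.

End TanComp.

Lemma t2_eq (X Y : TanCat) (H K : TanMor X Y) (a b : Tan2 H K) :
  t2 a = t2 b -> a = b.
Proof.
case: a b => [a aP] [b bP] /= ab.
by subst b; congr MkTan2; apply: proof_irrelevance.
Qed.

Definition t2_id (X Y : TanCat) (H : TanMor X Y) : Tan2 H H.
Proof.
by exists (nt_id H) => A /=; rewrite fmap1 cmp1m cmpm1.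
Defined.

Definition t2_cmp (X Y : TanCat) (H K L : TanMor X Y) (b : Tan2 K L)
    (a : Tan2 H K) : Tan2 H L.
Proof.
exists (nt_cmp b a) => A /=.
have aP := t2_dist a A; have bP := t2_dist b A.
by rewrite fmapM -cmpA aP [LHS]cmpA bP -cmpA.
Defined.

Definition TanHom (X Y : TanCat) : Category.
Proof.
refine (@MkCategory (TanMor X Y) (@Tan2 X Y) (@t2_id X Y) (@t2_cmp X Y) _ _ _).
- by move=> H K a; apply: t2_eq; apply: (@cmp1m (FunCat X Y)).
- by move=> H K a; apply: t2_eq; apply: (@cmpm1 (FunCat X Y)).
- by move=> H K L M c b a; apply: t2_eq; apply: (@cmpA (FunCat X Y)).
Defined.

Definition t2_hcmp (X Y Z : TanCat) (G G' : TanMor Y Z) (H H' : TanMor X Y)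
    (b : Tan2 G G') (a : Tan2 H H') : Tan2 (tm_cmp G H) (tm_cmp G' H').
Proof.
exists (nt_hcmp b a) => A /=.
have bN B C (f : hom B C) : fmap G' f ∘ b B = b C ∘ fmap G f := ntN b f.
have gN : fmap (tstr Z) (fmap G (a A)) ∘ fwd (tm_dist G) (H A) =
    fwd (tm_dist G) (H' A) ∘ fmap G (fmap (tstr Y) (a A)) :=
  ntN (fwd (tm_dist G)) (a A).
rewrite fmapM !cmpA -(cmpA _ (fmap (tstr Z) (fmap G (a A)))) gN cmpA (t2_dist b).
have := f_equal (fmap G) (t2_dist a A); rewrite !fmapM => E.
by rewrite -[LHS]cmpA E -(cmpA _ (fmap G' _)) bN !cmpA.
Defined.

Lemma t2_bwd_dist (X Y : TanCat) (H K : TanMor X Y)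
    (i : @Iso (FunCat X Y) H K)
    (iP : forall A : X,
      fmap (tstr Y) (fwd i A) ∘ fwd (tm_dist H) A =
      fwd (tm_dist K) A ∘ fwd i (tstr X A)) (A : X) :
  fmap (tstr Y) (bwd i A) ∘ fwd (tm_dist K) A =
  fwd (tm_dist H) A ∘ bwd i (tstr X A).
Proof.
have E1 : fmap (tstr Y) (bwd i A) ∘ fmap (tstr Y) (fwd i A) =
    idm (tstr Y (H A)) by rewrite -fmapM nt_bf fmap1.
rewrite -[X in X = _]cmpm1 -(nt_fb i) !cmpA -(cmpA _ (fwd (tm_dist K) A)) -iP.
by rewrite !cmpA E1 cmp1m.
Qed.

Definition t2_iso (X Y : TanCat) (H K : TanMor X Y)
    (i : @Iso (FunCat X Y) H K)
    (iP : forall A : X,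
      fmap (tstr Y) (fwd i A) ∘ fwd (tm_dist H) A =
      fwd (tm_dist K) A ∘ fwd i (tstr X A)) :
    @Iso (TanHom X Y) H K.
Proof.
by refine (@MkIso (TanHom X Y) H K (@MkTan2 X Y H K (fwd i) iP)
   (@MkTan2 X Y K H (bwd i) (t2_bwd_dist iP)) _ _); apply: t2_eq;
  [apply: (iso_bf i) | apply: (iso_fb i)].
Defined.

Definition tan_assoc (A B C D : TanCat) (K : TanMor C D) (H : TanMor B C)
    (G : TanMor A B) :
    @Iso (TanHom A D) (tm_cmp K (tm_cmp H G)) (tm_cmp (tm_cmp K H) G).
Proof.
apply: (@t2_iso A D (tm_cmp K (tm_cmp H G)) (tm_cmp (tm_cmp K H) G)
          (cat_assoc K H G)) => x /=.
by rewrite fmap1 cmp1m cmpm1 fmapM cmpA.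
Defined.

Definition tan_lun (A B : TanCat) (F : TanMor A B) :
    @Iso (TanHom A B) (tm_cmp (tm_id B) F) F.
Proof.
apply: (@t2_iso A B (tm_cmp (tm_id B) F) F (cat_lun F)) => x /=.
by rewrite fmap1 !cmp1m cmpm1.
Defined.

Definition tan_run (A B : TanCat) (F : TanMor A B) :
    @Iso (TanHom A B) (tm_cmp F (tm_id A)) F.
Proof.
apply: (@t2_iso A B (tm_cmp F (tm_id A)) F (cat_run F)) => x /=.
by rewrite !fmap1 cmp1m.
Defined.

Definition Tan : Bicategory.
Proof.
refine (@MkBicategory TanCat TanHom tm_id tm_cmp t2_hcmp tan_assoc tan_lun
          tan_run _ _ _ _ _ _ _).
- move=> a b c g f; apply: t2_eq.
  exact: (@bhcmp1 Cat a b c g f).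
- move=> a b c g g' g'' f f' f'' v' v u' u; apply: t2_eq.
  exact: (@bhcmpM Cat a b c g g' g'' f f' f'' v' v u' u).
- move=> a b c d h h' g g' f f' w v u; apply: t2_eq.
  exact: (@bassocN Cat a b c d h h' g g' f f' w v u).
- move=> a b f f' u; apply: t2_eq.
  exact: (@blunN Cat a b f f' u).
- move=> a b f f' u; apply: t2_eq.
  exact: (@brunN Cat a b f f' u).
- move=> a b c d e k h g f; apply: t2_eq.
  exact: (@bpentagon Cat a b c d e k h g f).
- move=> a b c g f; apply: t2_eq.
  exact: (@btriangle Cat a b c g f).
Defined.

Definition forget_iso (X Y : TanCat) (H K : TanMor X Y)
    (i : @Iso (TanHom X Y) H K) : @Iso (FunCat X Y) H K :=
  @MkIso (FunCat X Y) H K (t2 (fwd i)) (t2 (bwd i))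
    (f_equal (@t2 X Y H H) (iso_bf i)) (f_equal (@t2 X Y K K) (iso_fb i)).

Lemma t2_eq_hom (X Y : TanCat) (H K : TanMor X Y) (e : H = K)
    (e' : tm_fun H = tm_fun K) :
  t2 (@eq_hom (TanHom X Y) H K e) = @eq_hom (FunCat X Y) H K e'.
Proof. by destruct e; rewrite (proof_irrelevance _ e' erefl). Qed.

(* Postcomposition with the forgetful 2-functor [Tan -> Cat]. *)
Definition forget_pf (C : Category) (G : Pseudofunctor C Tan) :
    Pseudofunctor C Cat.
Proof.
refine (@MkPseudofunctor C Cat
  (fun x => tcat (G x))
  (fun x y f => tm_fun (pf_map G f))
  (fun x y z g f => forget_iso (pf_cmp G g f))
  (fun x => f_equal (@tm_fun (G x) (G x)) (pf_id G x)) _ _ _).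
- move=> x y z w h g f.
  rewrite -(@t2_eq_hom (G x) (G w) _ _
              (f_equal (@pf_map C Tan G x w) (cmpA h g f))).
  exact: (f_equal (fun a => t2 a) (pf_assoc G h g f)).
- move=> x y f.
  rewrite -(@t2_eq_hom (G x) (G y) _ _
              (f_equal (@pf_map C Tan G x y) (cmp1m f))).
  rewrite -(@t2_eq_hom (G y) (G y) _ _ (pf_id G y)).
  exact: (f_equal (fun a => t2 a) (pf_unitl G f)).
- move=> x y f.
  rewrite -(@t2_eq_hom (G x) (G y) _ _
              (f_equal (@pf_map C Tan G x y) (cmpm1 f))).
  rewrite -(@t2_eq_hom (G x) (G x) _ _ (pf_id G x)).
  exact: (f_equal (fun a => t2 a) (pf_unitr G f)).
Defined.

(* [f : X -> Y] in [C] is a morphism [Y -> X] of [op C], hence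
   [pf_map F f : F Y -> F X]. *)
Record TangentIndexingData (C : Category) (F : Pseudofunctor (op C) Cat) :=
  MkTangentIndexingData {
  ti_str : forall X : C, TangentStructure (F X);
  ti_dist : forall (X Y : C) (f : @hom C X Y),
      @Iso (FunCat (F Y) (F X))
        (Fcomp (pf_map F f) (ti_str Y)) (Fcomp (ti_str X) (pf_map F f)) }.

Record TangentIndexingFunctor (C : Category) := MkTangentIndexingFunctor {
  ti_pf :> Pseudofunctor (op C) Cat;
  ti_data : TangentIndexingData ti_pf;
  ti_strong : forall (X Y : C) (f : @hom C X Y),
      is_strong_tangent (T := ti_str ti_data Y) (S := ti_str ti_data X)
        (ti_dist ti_data f);
  ti_pseudonat :
      @is_pseudonatural (op C) Cat ti_pf ti_pf (fun X => ti_str ti_data X)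
        (fun Y X (f : @hom (op C) Y X) => iso_inv (ti_dist ti_data f)) }.

Definition TangentIndexingDatum (C : Category) :=
  {F : Pseudofunctor (op C) Cat & TangentIndexingData F}.

Definition ti_datum (C : Category) (F : TangentIndexingFunctor C) :
    TangentIndexingDatum C :=
  existT _ (ti_pf F) (ti_data F).

Definition forget_datum (C : Category) (G : Pseudofunctor (op C) Tan) :
    TangentIndexingDatum C :=
  existT _ (forget_pf G)
    (@MkTangentIndexingData C (forget_pf G) (fun X => tstr (G X))
       (fun X Y f => tm_dist (pf_map G f))).

Definition pf_graph (C : Category) (B : Bicategory) (F : Pseudofunctor C B) :
    {o : C -> B & forall x y : C, hom x y -> bhom (o x) (o y)} :=
  existT _ (pf_ob F) (@pf_map C B F).

Definition under_ob (C : Category) (F : TangentIndexingFunctor C) (X : op C) :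
    Tan :=
  @MkTanCat (F X) (ti_str (ti_data F) X).

Definition under_map (C : Category) (F : TangentIndexingFunctor C)
    (Y X : op C) (f : hom Y X) : bhom (under_ob F Y) (under_ob F X) :=
  @MkTanMor (under_ob F Y) (under_ob F X) (pf_map F f) (ti_dist (ti_data F) f)
    (ti_strong F f).

Definition under_graph (C : Category) (F : TangentIndexingFunctor C) :
    {o : op C -> Tan & forall x y : op C, hom x y -> bhom (o x) (o y)} :=
  existT _ (under_ob F) (@under_map C F).

(* The compositors of [F] and [G] agree by [corr_forget]: those of
   [forget_pf G] are the transformations underlying those of [G]. *)
Record corresponds (C : Category) (F : TangentIndexingFunctor C)
    (G : Pseudofunctor (op C) Tan) : Prop := {
  corr_under : pf_graph G = under_graph F;
  corr_forget : forget_datum G = ti_datum F }.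

(* Main.v *)
Require Import Defs.
From mathcomp Require Import ssreflect ssrfun.
From Stdlib Require Import FunctionalExtensionality ProofIrrelevance.

(** Given the strong tangent morphisms [(F f, fT)], condition (iii) says exactly
    that the compositors and the normalized units of [F] are 2-cells of
    [Tan]: inverting the distributive laws turns the two coherence axioms of a
    pseudonatural transformation [F => F] into compatibility with [fT].  The
    coherence equations of both pseudofunctors coincide because [Tan -> Cat] is
    faithful on 2-cells, so the two passages only regroup the same data and are
    mutually inverse. *)

Set Implicit Arguments.
Unset Strict Implicit.
Unset Printing Implicit Defensive.

Local Open Scope cat_scope.

Lemma iso_eq (C : Category) (x y : C) (i j : Iso x y) :
  fwd i = fwd j -> bwd i = bwd j -> i = j.
Proof.
case: i j => [f b bf fb] [f' b' bf' fb'] /= ef eb.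
by subst f' b'; congr MkIso; apply: proof_irrelevance.
Qed.

(** Bridge between two conventions: 2-cells of [Tan] are squares on the distributive laws, condition
    (iii) uses squares on their inverses. *)
Lemma square_inv (C : Category) (x y x' y' : C) (a : hom x y) (a' : hom y x)
    (b : hom x' y') (b' : hom y' x') (u : hom x x') (v : hom y y') :
  a' ∘ a = idm x -> b' ∘ b = idm x' -> a ∘ a' = idm y -> b ∘ b' = idm y' ->
  v ∘ a = b ∘ u <-> b' ∘ v = u ∘ a'.
Proof.
move=> a'a b'b aa' bb'; split=> e.
  by rewrite -[b' ∘ v]cmpm1 -aa' -cmpA (cmpA v) e !cmpA b'b cmp1m.
by rewrite -[v ∘ a]cmp1m -bb' -cmpA (cmpA b') e -!cmpA a'a cmpm1.
Qed.

Lemma tm_eq (X Y : TanCat) (H K : TanMor X Y) (e : tm_fun H = tm_fun K) :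
  (forall A : X,
    fmap (tstr Y) (@eq_hom (FunCat X Y) _ _ e A) ∘ fwd (tm_dist H) A =
    fwd (tm_dist K) A ∘ @eq_hom (FunCat X Y) _ _ e (tstr X A)) ->
  H = K.
Proof.
case: H K e => [H a aP] [K b bP] /= e; destruct e => /= ab.
have {}ab A : fwd a A = fwd b A.
  by have := ab A; rewrite fmap1 cmp1m cmpm1.
suff E : a = b by subst b; congr MkTanMor; apply: proof_irrelevance.
apply: iso_eq; apply: nt_eq => // A.
(* The backward components agree too, since inverses are unique. *)
by rewrite -[LHS]cmpm1 -(nt_fb b) -ab cmpA nt_bf cmp1m.
Qed.

(** Beyond the graph only the compositors carry data: normalized units are equalities, so proof
    irrelevance identifies them along with the coherence axioms. *)
Lemma pf_eq (C : Category) (B : Bicategory) (o : C -> B)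
    (m : forall x y : C, hom x y -> bhom (o x) (o y)) c c' i i' a a' l l' r r' :
  (forall x y z g f, c x y z g f = c' x y z g f) ->
  @MkPseudofunctor C B o m c i a l r = @MkPseudofunctor C B o m c' i' a' l' r'.
Proof.
move=> cc'.
have {cc'} E : c = c'.
  by do 5!apply: functional_extensionality_dep => ?; exact: cc'.
subst c'; have E : i = i' by exact: proof_irrelevance.
by subst i'; congr MkPseudofunctor; apply: proof_irrelevance.
Qed.

(** The types of [s] and [d] mention only [o] and [m], so the same tangent data fits both
    pseudofunctors without transport. *)
Lemma datum_eq (C : Category) (o : op C -> Cat)
    (m : forall x y : op C, hom x y -> bhom (o x) (o y))
    c c' i i' a a' l l' r r'
    (s : forall X : C, TangentStructure (o X))
    (d : forall (X Y : C) (f : @hom C X Y),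
      @Iso (FunCat (o Y) (o X)) (Fcomp (m _ _ f) (s Y)) (Fcomp (s X) (m _ _ f))) :
  (forall x y z g f, c x y z g f = c' x y z g f) ->
  let F := @MkPseudofunctor (op C) Cat o m c i a l r in
  let F' := @MkPseudofunctor (op C) Cat o m c' i' a' l' r' in
  existT (fun F => TangentIndexingData F) F (@MkTangentIndexingData C F s d) =
  existT (fun F => TangentIndexingData F) F' (@MkTangentIndexingData C F' s d).
Proof.
move=> cc'.
have {cc'} E : c = c'.
  by do 5!apply: functional_extensionality_dep => ?; exact: cc'.
subst c'; have E : i = i' by exact: proof_irrelevance.
subst i'.
by rewrite (proof_irrelevance _ a' a) (proof_irrelevance _ l' l)
  (proof_irrelevance _ r' r).
Qed.

Lemma ti_eq (C : Category) (F F' : TangentIndexingFunctor C) :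
  ti_datum F = ti_datum F' -> F = F'.
Proof.
(* Rebuilding the functor from its datum lets the equality of dependent pairs be substituted; the
   other fields are propositions. *)
pose mk (D : TangentIndexingDatum C) :=
  @MkTangentIndexingFunctor C (projT1 D) (projT2 D).
suff E (D D' : TangentIndexingDatum C) s s' p p' :
    D = D' -> mk D s p = mk D' s' p'.
  exact: (E (ti_datum F) (ti_datum F') (ti_strong F) (ti_strong F')
            (ti_pseudonat F) (ti_pseudonat F')).
by move=> E; subst D'; congr (mk D); apply: proof_irrelevance.
Qed.

Section ToTan.

Variables (C : Category) (F : TangentIndexingFunctor C).

Lemma under_id (X : op C) : under_map F (idm X) = tm_id (under_ob F X).
Proof.
apply: (@tm_eq _ _ (under_map F (idm X)) (tm_id (under_ob F X)) (pf_id F X)) => A.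
(* The unit axiom, composed with the distributive law, is the compatibility that [tm_eq]
   requires. *)
have /= := f_equal (fun t => nt t A) (psn_id (ti_pseudonat F) X).
rewrite !cmp1m fmap1 ?cmpm1 => E.
by rewrite -E -cmpA (nt_bf (ti_dist (ti_data F) (idm X))) cmpm1.
Qed.

Lemma under_cmp_dist (X Y Z : op C) (g : hom Y Z) (f : hom X Y) (A : F X) :
  fmap (ti_str (ti_data F) Z) (fwd (pf_cmp F g f) A) ∘
    fwd (tm_dist (tm_cmp (under_map F g) (under_map F f))) A =
  fwd (tm_dist (under_map F (g ∘ f))) A ∘
    fwd (pf_cmp F g f) (ti_str (ti_data F) X A).
Proof.
have /= := f_equal (fun t => nt t A) (psn_cmp (ti_pseudonat F) g f).
rewrite ?fmap1 ?cmp1m ?cmpm1 => E.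
exact: (proj2 (square_inv _ _
  (tm_bf (tm_cmp (under_map F g) (under_map F f)) A)
  (tm_bf (under_map F (g ∘ f)) A)
  (tm_fb (tm_cmp (under_map F g) (under_map F f)) A)
  (tm_fb (under_map F (g ∘ f)) A)) E).
Qed.

Definition under_cmp (X Y Z : op C) (g : hom Y Z) (f : hom X Y) :
    @Iso (TanHom (under_ob F X) (under_ob F Z))
      (tm_cmp (under_map F g) (under_map F f)) (under_map F (g ∘ f)) :=
  @t2_iso (under_ob F X) (under_ob F Z)
    (tm_cmp (under_map F g) (under_map F f)) (under_map F (g ∘ f))
    (pf_cmp F g f) (@under_cmp_dist X Y Z g f).

Definition under_pf : Pseudofunctor (op C) Tan.
Proof.
refine (@MkPseudofunctor (op C) Tan (under_ob F) (@under_map C F)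
          under_cmp under_id _ _ _).
- move=> x y z w h g f; apply: t2_eq => /=.
  (* Forgetting turns this [eq_hom] of tangent morphisms into the one of functors, so the axiom of
     [F] applies. *)
  rewrite (@t2_eq_hom _ _ (under_map F _) (under_map F _) _
             (f_equal (@pf_map _ _ F x w) (cmpA h g f))).
  exact: (pf_assoc F h g f).
- move=> x y f; apply: t2_eq => /=.
  rewrite (@t2_eq_hom _ _ (under_map F _) (under_map F _) _
             (f_equal (@pf_map _ _ F x y) (cmp1m f))).
  rewrite (@t2_eq_hom _ _ (under_map F _) (tm_id _) _ (pf_id F y)).
  exact: (pf_unitl F f).
- move=> x y f; apply: t2_eq => /=.
  rewrite (@t2_eq_hom _ _ (under_map F _) (under_map F _) _
             (f_equal (@pf_map _ _ F x y) (cmpm1 f))).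
  rewrite (@t2_eq_hom _ _ (under_map F _) (tm_id _) _ (pf_id F x)).
  exact: (pf_unitr F f).
Defined.

Lemma forget_under : forget_datum under_pf = ti_datum F.
Proof.
apply: (@datum_eq C (pf_ob F) (@pf_map _ _ F)) => x y z g f.
exact: iso_eq.
Qed.

End ToTan.

Section FromTan.

Variables (C : Category) (G : Pseudofunctor (op C) Tan).

Lemma forget_pseudonat :
  @is_pseudonatural (op C) Cat (forget_pf G) (forget_pf G)
    (fun X => tstr (G X)) (fun Y X f => iso_inv (tm_dist (pf_map G f))).
Proof.
split=> [X|X Y Z g f]; apply: nt_eq => A /=.
- rewrite !cmp1m fmap1 ?cmpm1.
  (* The unit of [G] is a 2-cell of [Tan]; its compatibility square gives the unit axiom. *)
  have /= := t2_dist (@eq_hom (TanHom (G X) (G X)) _ _ (pf_id G X)) A.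
  rewrite (@t2_eq_hom _ _ _ _ _ (f_equal (@tm_fun (G X) (G X)) (pf_id G X))).
  rewrite cmp1m => <-.
  by rewrite -cmpA tm_fb cmpm1.
- rewrite ?fmap1 ?cmp1m ?cmpm1.
  exact: (proj1 (square_inv _ _
    (tm_bf (tm_cmp (pf_map G g) (pf_map G f)) A)
    (tm_bf (pf_map G (g ∘ f)) A)
    (tm_fb (tm_cmp (pf_map G g) (pf_map G f)) A)
    (tm_fb (pf_map G (g ∘ f)) A)) (t2_dist (fwd (pf_cmp G g f)) A)).
Qed.

Definition forget_ti : TangentIndexingFunctor C :=
  @MkTangentIndexingFunctor C (forget_pf G) (projT2 (forget_datum G))
    (fun X Y f => tm_strong (pf_map G f)) forget_pseudonat.

End FromTan.

Lemma under_forget (C : Category) (G : Pseudofunctor (op C) Tan) :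
  under_pf (forget_ti G) = G.
Proof.
apply: (@pf_eq (op C) Tan (pf_ob G) (@pf_map _ _ G)) => x y z g f.
by apply: iso_eq; apply: t2_eq.
Qed.

Theorem proposition3p10 (C : Category) :
  exists (Phi : TangentIndexingFunctor C -> Pseudofunctor (op C) Tan)
         (Psi : Pseudofunctor (op C) Tan -> TangentIndexingFunctor C),
    (forall F : TangentIndexingFunctor C, corresponds F (Phi F)) /\
    (forall G : Pseudofunctor (op C) Tan, corresponds (Psi G) G) /\
    cancel Phi Psi /\ cancel Psi Phi.
Proof.
exists (@under_pf C), (@forget_ti C); split; [|split; [|split]].
- by move=> F; split; last exact: forget_under.
(* Both equalities hold by conversion, using eta for primitive records. *)
- by move=> G; split.
- by move=> F; apply: ti_eq; exact: forget_under.
- exact: under_forget.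
Qed.
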